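(* For any $m\ge 2$ and any integer $Q$, consider the hypergraph stochastic blockmodel (HSBM) with $Q$ groups restricted to simple $m$-uniform hypergraphs over $n$ nodes, with parameter $\theta=(\pi_q,B_{q_1,\dots,q_m})_{1\le q\le Q,\ 1\le q_1\le\dots\le q_m\le Q}$. This parameter is generically identifiable, up to label switching on the node groups, as soon as $$n\ \ge\ Q^2\big(m!\,Qm+m-1\big)^{2/(m-1)}.$$ Moreover, the result remains valid when the group proportions $\pi_q$ are fixed.
   Context: Nodes are $\mathcal V=\{1,\dots,n\}$. A simple $m$-uniform hypergraph on $\mathcal V$ is a set of $m$-element subsets (hyperedges) of $\mathcal V$; it is encoded by indicators $Y_{i_1,\dots,i_m}\in\{0,1\}$, one for each $m$-subset $\{i_1,\dots,i_m\}$ of $\mathcal V$. HSBM restricted to $m$-uniform hypergraphs: latent (unobserved) variables $Z_1,\dots,Z_n$ are i.i.d. with values in $\{1,\dots,Q\}$ and $\mathbb P(Z_i=q)=\pi_q$, where $\pi_q\ge 0$ and $\sum_q\pi_q=1$. Conditionally on $(Z_1,\dots,Z_n)$, the indicators $Y_{i_1,\dots,i_m}$ over all $m$-subsets are independent, and $Y_{i_1,\dots,i_m}$ is Bernoulli with parameter $B_{Z_{i_1},\dots,Z_{i_m}}\in[0,1]$, where $B$ is fully symmetric: $B_{q_1,\dots,q_m}=B_{q_{\sigma(1)},\dots,q_{\sigma(m)}}$ for every permutation $\sigma$ of $\{1,\dots,m\}$ (so it is determined by its values for $q_1\le\dots\le q_m$). $\mathbb P_\theta$ denotes the resulting distribution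 of the random hypergraph $(Y_{i_1,\dots,i_m})$ over the $n$ nodes. Generic identifiability means that the distribution $\mathbb P_\theta$ uniquely defines the parameter $\theta$, except possibly for some parameters in a subset of dimension strictly smaller than that of the full parameter space. ''Up to label switching'' means that uniqueness is understood up to a permutation $s$ of $\{1,\dots,Q\}$ acting on parameters by $\pi_q\mapsto\pi_{s(q)}$, $B_{q_1,\dots,q_m}\mapsto B_{s(q_1),\dots,s(q_m)}$.
   Formalization: When the group proportions are fixed, they are assumed to be all strictly positive; if some proportion is zero and Q ≥ 2, the connection probabilities involving that group do not affect the distribution, so the claim fails. *)

(* Defs.v *)
From mathcomp Require Import all_boot all_order all_algebra all_fingroup.
From mathcomp Require Import boolp classical_sets reals exp.
From mathcomp Require Import bernoulli_distribution.
From mathcomp Require Import -(notations) mpoly.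
Set Implicit Arguments.
Unset Strict Implicit.
Unset Printing Implicit Defensive.
Import Order.TTheory GRing.Theory Num.Theory.
Local Open Scope classical_set_scope.
Local Open Scope ring_scope.

(* For S a set of points of R^T, [algebraically_independent S J] means that the
   coordinates in J satisfy no nonzero polynomial relation on S: the vanishing
   ideal I(S) meets R[x_j : j in J] only in 0.  The largest size of such a J is
   the Krull dimension of R[x]/I(S), that is, the dimension of the Zariski
   closure of S; for semialgebraic S it is the usual dimension of S.
   By this convention the empty set has dimension 0 (and not -1 or -oo). *)
Definition algebraically_independent (R : realType) (T : finType)
    (S : set (T -> R)) (J : {set T}) : Prop :=
  forall p : mpoly.mpoly #|J| R,
    (forall x, S x -> mpoly.meval (fun i => x (enum_val i)) p = 0) -> p = 0.

Definition dimension (R : realType) (T : finType) (S : set (T -> R)) : nat :=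
  \max_(J : {set T} | `[< algebraically_independent S J >]) #|J|.

(* [law th] is the probability mass function of the observation under the
   parameter th in the parameter space Theta; [same th th'] is the equivalence
   up to which th is to be recovered. *)
Definition generically_identifiable (R : realType) (T : finType) (O : Type)
    (Theta : set (T -> R)) (law : (T -> R) -> O -> R)
    (same : (T -> R) -> (T -> R) -> Prop) : Prop :=
  exists E : set (T -> R),
    [/\ E `<=` Theta, (dimension E < dimension Theta)%N &
      forall th th', Theta th -> ~ E th -> Theta th' ->
        (forall y, law th y = law th' y) -> same th th'].

(* The tuples q_1 <= ... <= q_m of groups. *)
Definition group_index (Q m : nat) : Type :=
  {q : m.-tuple 'I_Q | sorted <=%O q}.

(* The free coordinates of theta: the pi_q, and the B_{q_1,...,q_m} with
   q_1 <= ... <= q_m. *)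
Definition hsbm_coord (Q m : nat) : Type := ('I_Q + group_index Q m)%type.

Definition hsbm_param (R : realType) (Q m : nat) : Type := hsbm_coord Q m -> R.

Definition proportion (R : realType) (Q m : nat) (th : hsbm_param R Q m)
  (q : 'I_Q) : R := th (inl q).

Definition sort_groups (Q m : nat) (q : m.-tuple 'I_Q) : group_index Q m :=
  exist _ [tuple of sort <=%O q] (sort_le_sorted q).

(* B_{q_1,...,q_m} for an arbitrary tuple, by full symmetry. *)
Definition connection (R : realType) (Q m : nat) (th : hsbm_param R Q m)
  (q : m.-tuple 'I_Q) : R := th (inr (sort_groups q)).

Definition hsbm_space (R : realType) (Q m : nat) : set (hsbm_param R Q m) :=
  [set th | [/\ forall q, 0 <= proportion th q,
                \sum_q proportion th q = 1 &
                forall q, 0 <= connection th q <= 1]].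

Definition hsbm_space_fixed (R : realType) (Q m : nat) (p : 'I_Q -> R) :
    set (hsbm_param R Q m) :=
  [set th | hsbm_space th /\ forall q, proportion th q = p q].

Definition label_switching (R : realType) (Q m : nat)
    (th th' : hsbm_param R Q m) : Prop :=
  exists s : {perm 'I_Q},
    (forall q, proportion th' q = proportion th (s q)) /\
    (forall q, connection th' q = connection th (map_tuple s q)).

Definition hyperedge (n m : nat) : Type := {e : {set 'I_n} | #|e| == m}.

(* A simple m-uniform hypergraph, given by its indicators Y_e. *)
Definition hypergraph (n m : nat) : Type := {ffun hyperedge n m -> bool}.

Lemma size_edge_groups (Q n m : nat) (z : {ffun 'I_n -> 'I_Q})
  (e : hyperedge n m) : size [seq z i | i <- enum (val e)] == m.
Proof. by rewrite size_map -cardE (valP e). Qed.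

(* (z_{i_1}, ..., z_{i_m}) for e = {i_1 < ... < i_m}. *)
Definition edge_groups (Q n m : nat) (z : {ffun 'I_n -> 'I_Q})
  (e : hyperedge n m) : m.-tuple 'I_Q := Tuple (size_edge_groups z e).

Definition latent_pmf (R : realType) (Q m n : nat) (th : hsbm_param R Q m)
  (z : {ffun 'I_n -> 'I_Q}) : R := \prod_i proportion th (z i).

Definition conditional_pmf (R : realType) (Q m n : nat) (th : hsbm_param R Q m)
    (z : {ffun 'I_n -> 'I_Q}) (y : hypergraph n m) : R :=
  \prod_e bernoulli_pmf (connection th (edge_groups z e)) (y e).

Definition hsbm_law (R : realType) (Q m n : nat) (th : hsbm_param R Q m)
    (y : hypergraph n m) : R :=
  \sum_z latent_pmf th z * conditional_pmf th z y.

(* Main.v *)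
Require Import Defs.
From mathcomp Require Import all_boot all_order all_algebra all_fingroup.
From mathcomp Require Import boolp classical_sets reals exp.
From mathcomp Require Import bernoulli_distribution.
From mathcomp Require Import -(notations) mpoly.
From mathcomp Require Import ring zify.
(* Write d(s) for the conditional probability of a hyperedge given that some of
   its nodes have the groups s, so that d is B on tuples of length m.
   Hyperedges which meet only in a core of r nodes are conditionally independent
   given the groups of the core, so the law determines the moments
   E[prod_j d(w_(S_j))], for w the groups of the core and S_j its subsets.
   - For r = 1, the moments E[d(w)^k] with k < 2Q determine pi and q |-> d(q) up
     to a permutation of the groups, provided the d(q) are distinct and pi > 0.
   - For 2 <= r <= m, assuming d known on tuples shorter than r, one adds to the
     full core, for k in {0,...,Q-1}^r and each l < Q-1, two hyperedges which
     split the positions i with l < k_i into proper subsets of the core.  This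
     gives a linear system for d on r-tuples, whose matrix is, for
     B = prod_j x_(q_j), a product of powers of sum_q pi_q x_q with the entries
     prod_i x_(w_i)^(k_i) of a tensor power of a Vandermonde matrix; hence it is
     generically invertible.
   At most m + 2(Q-1)m <= Q^2 m <= n nodes are used.  The excluded parameters are
   the zeros of a polynomial which does not vanish identically, whatever the
   positive proportions. *)

Set Implicit Arguments.
Unset Strict Implicit.
Unset Printing Implicit Defensive.
Import Order.TTheory GRing.Theory Num.Theory.
Local Open Scope ring_scope.

(** * Polynomial functions of selected coordinates *)

Inductive polynomial_fun (R : realType) (T : finType) (J : {set T}) :
    ((T -> R) -> R) -> Prop :=
| polynomial_fun_cst c : polynomial_fun J (fun=> c)
| polynomial_fun_coord t of t \in J : polynomial_fun J (fun x => x t)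
| polynomial_funD F G of polynomial_fun J F & polynomial_fun J G :
    polynomial_fun J (fun x => F x + G x)
| polynomial_funM F G of polynomial_fun J F & polynomial_fun J G :
    polynomial_fun J (fun x => F x * G x).

Section PolynomialFunctions.
Context (R : realType) (T : finType).
Implicit Types (J : {set T}) (F G : (T -> R) -> R).

Lemma polynomial_funB J F G : polynomial_fun J F -> polynomial_fun J G ->
  polynomial_fun J (fun x => F x - G x).
Proof.
move=> hF hG.
have -> : (fun x => F x - G x) = (fun x => F x + (-1) * G x).
  by apply/funext => x; rewrite mulN1r.
by apply: polynomial_funD => //; apply: polynomial_funM => //; constructor.
Qed.

Lemma polynomial_fun_sum J I (r : seq I) (P : pred I) (F : I -> (T -> R) -> R) :
  (forall i, P i -> polynomial_fun J (F i)) ->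
  polynomial_fun J (fun x => \sum_(i <- r | P i) F i x).
Proof.
move=> hF; elim: r => [|i r IH].
  have -> : (fun x => \sum_(i <- [::] | P i) F i x) = (fun=> 0).
    by apply/funext => x; rewrite big_nil.
  exact: polynomial_fun_cst.
have -> : (fun x => \sum_(j <- i :: r | P j) F j x) =
    (fun x => (if P i then F i x else 0) + \sum_(j <- r | P j) F j x).
  by apply/funext => x; rewrite big_cons; case: (P i); rewrite ?add0r.
apply: polynomial_funD => //; case Pi: (P i); [exact: hF|exact: polynomial_fun_cst].
Qed.

Lemma polynomial_fun_prod J I (r : seq I) (P : pred I) (F : I -> (T -> R) -> R) :
  (forall i, P i -> polynomial_fun J (F i)) ->
  polynomial_fun J (fun x => \prod_(i <- r | P i) F i x).
Proof.
move=> hF; elim: r => [|i r IH].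
  have -> : (fun x => \prod_(i <- [::] | P i) F i x) = (fun=> 1).
    by apply/funext => x; rewrite big_nil.
  exact: polynomial_fun_cst.
have -> : (fun x => \prod_(j <- i :: r | P j) F j x) =
    (fun x => (if P i then F i x else 1) * \prod_(j <- r | P j) F j x).
  by apply/funext => x; rewrite big_cons; case: (P i); rewrite ?mul1r.
apply: polynomial_funM => //; case Pi: (P i); [exact: hF|exact: polynomial_fun_cst].
Qed.

Lemma polynomial_fun_det J k (A : (T -> R) -> 'M[R]_k) :
  (forall i j, polynomial_fun J (fun x => A x i j)) ->
  polynomial_fun J (fun x => \det (A x)).
Proof.
move=> hA; apply: polynomial_fun_sum => s _.
apply: polynomial_funM; first exact: polynomial_fun_cst.
exact: polynomial_fun_prod.
Qed.

Lemma polynomial_fun_comp J F (rho : (T -> R) -> T -> R) :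
  polynomial_fun [set: T] F ->
  (forall t, polynomial_fun J (fun x => rho x t)) ->
  polynomial_fun J (fun x => F (rho x)).
Proof.
move=> hF hrho; elim: hF => [c|t _|G H _ IHG _ IHH|G H _ IHG _ IHH].
- exact: polynomial_fun_cst.
- exact: hrho.
- exact: polynomial_funD.
- exact: polynomial_funM.
Qed.

Lemma polynomial_fun_mpoly J F : polynomial_fun J F ->
  exists p : mpoly.mpoly #|J| R,
    forall x, F x = meval (fun i => x (enum_val i)) p.
Proof.
elim=> [c|t tJ|G H _ [p hp] _ [q hq]|G H _ [p hp] _ [q hq]].
- by exists (mpolyC _ c) => x; rewrite mevalC.
- exists (mpolyX _ (mnm1 (enum_rank_in tJ t))) => x.
  by rewrite mevalXU enum_rankK_in.
- by exists (p + q) => x; rewrite mevalD hp hq.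
- by exists (p * q) => x; rewrite mevalM hp hq.
Qed.

(** [F] comes from the zero polynomial in the coordinates of [J], so it also vanishes outside [S],
    at points which need not be parameters. *)
Lemma algebraically_independent_eq0 (S : set (T -> R)) J F :
  algebraically_independent S J -> polynomial_fun J F ->
  (forall x, S x -> F x = 0) -> forall x, F x = 0.
Proof.
move=> indJ /polynomial_fun_mpoly[p hp] F0 x.
by rewrite hp (indJ p) ?meval0// => y Sy; rewrite -hp F0.
Qed.

End PolynomialFunctions.

(** * Polynomials that vanish on a small box *)

Section Kronecker.
Context (R : realType).

Fixpoint digits_value (D : nat) (s : seq nat) : nat :=
  if s is a :: s' then digits_value D s' * D + a else 0.

Lemma digits_value_inj (D : nat) (s s' : seq nat) :
  size s = size s' -> all (fun a => a < D)%N s -> all (fun a => a < D)%N s' ->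
  digits_value D s = digits_value D s' -> s = s'.
Proof.
elim: s s' => [|a s IH] [|b s'] //= [] hs /andP[aD sD] /andP[bD sD'] E.
have ab : a = b by have := congr1 (modn^~ D) E; rewrite !modnMDl ?modn_small.
rewrite ab in E *; congr (_ :: _); apply: IH => //.
by move/addIn/eqP: E; rewrite eqn_pmul2r ?(leq_ltn_trans _ bD)// => /eqP.
Qed.

Lemma prod_digits_value (k D : nat) (t : R) (s : seq nat) : size s = k ->
  \prod_(i < k) (t ^+ (D ^ i)) ^+ nth 0 s i = t ^+ digits_value D s.
Proof.
move=> <-; elim: s t => [|a s IH] t /=; first by rewrite big_ord0.
rewrite big_ord_recl /= expr1 addnC exprD; congr (_ * _).
rewrite mulnC exprM -IH; apply: eq_bigr => i _ /=.
by rewrite -!exprM expnS mulnA.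
Qed.

Lemma poly_eq0_small (e : R) (p : {poly R}) :
  0 < e -> (forall t, 0 <= t <= e -> p.[t] = 0) -> p = 0.
Proof.
move=> e0 p0.
(* These points are as many distinct roots in the interval as the size of [p]. *)
pose s := [seq e / (i.+1)%:R | i <- iota 0 (size p)].
apply: (@roots_geq_poly_eq0 _ p s).
- apply/allP => _ /mapP[i _ ->]; rewrite /root p0// ler_piMr ?(ltW e0)//.
    by rewrite divr_ge0 ?(ltW e0).
  by rewrite invf_le1 ?ltr0Sn// ler1n.
- rewrite map_inj_uniq ?iota_uniq// => i j /(mulfI (lt0r_neq0 e0))/invr_inj.
  by move=> /(mulrIn (oner_neq0 R))[].
- by rewrite size_map size_iota.
Qed.

(* Kronecker substitution: for D above all exponents, v_i = t^(D^i) maps the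
   monomials of p to distinct powers of t. *)
Lemma mpoly_eq0_box (k : nat) (e : R) (p : mpoly.mpoly k R) :
  0 < e <= 1 ->
  (forall v : 'I_k -> R, (forall i, 0 <= v i <= e) -> meval v p = 0) -> p = 0.
Proof.
move=> /andP[e0 e1] p0.
pose D := (\max_(mm <- msupp p) \max_(i < k) (mm i)).+1.
pose code (mm : multinom k) := digits_value D mm.
have codeE (t : R) (mm : multinom k) : \prod_(i < k) (t ^+ (D ^ i)) ^+ (mm i) = t ^+ code mm.
  rewrite /code -(@prod_digits_value k) ?size_tuple//; apply: eq_bigr => i _.
  by rewrite (mnm_nth 0%N).
pose P : {poly R} := \sum_(mm <- msupp p) mcoeff mm p *: 'X^(code mm).
have P0 : P = 0.
  apply: (@poly_eq0_small e) => // t /andP[t0 te].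
  rewrite -(p0 (fun i => t ^+ (D ^ i))); last first.
    move=> i; rewrite exprn_ge0//=.
    have -> : (D ^ i = (D ^ i).-1.+1)%N by rewrite prednK// expn_gt0.
    rewrite exprS -[leRHS]mulr1 ler_pM ?exprn_ge0// exprn_ile1//.
    exact: le_trans te e1.
  rewrite mevalE horner_sum; apply: eq_bigr => mm _.
  by rewrite hornerZ hornerXn codeE.
apply/mpolyP => mm; rewrite mcoeff0.
have [mmp|] := boolP (mm \in msupp p); last exact: memN_msupp_eq0.
have := congr1 (fun q : {poly R} => q`_(code mm)) P0.
rewrite coef0 coef_sum (bigD1_seq mm) ?msupp_uniq//= coefZ coefXn eqxx mulr1.
rewrite big_seq_cond big1 ?addr0// => m' /andP[m'p nm].
rewrite coefZ coefXn; case: eqP; rewrite ?mulr0// => E.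
have Dlt m0 : m0 \in msupp p -> all (fun a => a < D)%N m0.
  move=> m0p; apply/allP => _ /tnthP[i ->].
  rewrite ltnS -mnm_tnth.
  apply: leq_trans (leq_bigmax_seq _ m0p isT).
  exact: (leq_bigmax i).
case/eqP: nm; apply/val_inj/val_inj => /=.
by apply: (@digits_value_inj D); rewrite ?Dlt ?size_tuple.
Qed.
End Kronecker.

(** * Bounds on the dimension of a set *)

Section Dimension.
Context (R : realType) (T : finType).
Implicit Types (S : set (T -> R)) (J : {set T}).

Lemma leq_dimension S J : algebraically_independent S J -> (#|J| <= dimension S)%N.
Proof. by move=> indJ; apply: (leq_bigmax_cond J); exact/asboolP. Qed.

(** The condition [0 < d] accounts for the sets without any independent [J], such as the empty one:
    their dimension is 0, an empty maximum. *)
Lemma dimension_lt S d : (0 < d)%N ->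
  (forall J, algebraically_independent S J -> (#|J| < d)%N) -> (dimension S < d)%N.
Proof.
case: d => // d _ ltd; rewrite ltnS; apply/bigmax_leqP => J /asboolP indJ.
by rewrite -ltnS ltd.
Qed.

(** The projection of [S] to [J] contains the box [[0, e]^J], on which only the zero polynomial
    vanishes. *)
Lemma algebraically_independent_box S J (e : R) : 0 < e <= 1 ->
  (forall y : T -> R, (forall t, 0 <= y t <= e) ->
     exists2 x, S x & {in J, x =1 y}) ->
  algebraically_independent S J.
Proof.
move=> e01 ext p p0; apply: (mpoly_eq0_box e01) => v v01.
pose y t := if [pick i : 'I_#|J| | enum_val i == t] is Some i then v i else 0.
have yE i : y (enum_val i) = v i.
  rewrite /y; case: pickP => [j /eqP/enum_val_inj -> //|/(_ i)].
  by rewrite eqxx.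
have [t|x Sx xJ] := ext y.
  by rewrite /y; case: pickP => // _; rewrite lexx/= ltW//; case/andP: e01.
by rewrite -(p0 x Sx); apply: meval_eq => i; rewrite xJ ?yE ?enum_valP.
Qed.

End Dimension.

(** * Dimension of the parameter spaces and of zero sets in them *)

Section HsbmDimension.
Context (R : realType) (Q m : nat).
Hypotheses (Q_gt0 : (0 < Q)%N).
Let T : finType := hsbm_coord Q m.
Implicit Types (F : hsbm_param R Q m -> R).

Lemma card_hsbm_coord : #|T| = (Q + #|{: group_index Q m}|)%N.
Proof. by rewrite card_sum card_ord. Qed.

Lemma card_group_index_gt0 : (0 < #|{: group_index Q m}|)%N.
Proof.
apply/card_gt0P; exists (sort_groups (nseq_tuple m (Ordinal Q_gt0))).
by rewrite inE.
Qed.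

(** All coordinates except one proportion are free in [[0, 1/Q]]: the other [Q - 1] proportions then
    sum to at most 1. *)
Lemma dimension_hsbm_space : (#|T|.-1 <= dimension (@hsbm_space R Q m))%N.
Proof.
pose q0 := Ordinal Q_gt0.
have <- : #|[set: T] :\ inl q0| = #|T|.-1.
  by have := cardsD1 (inl q0) [set: T]; rewrite inE cardsT add1n => ->.
apply/leq_dimension/(@algebraically_independent_box _ _ _ _ Q%:R^-1).
  by rewrite invr_gt0 ltr0n Q_gt0 invf_le1 ?ltr0n// ler1n.
move=> y y01.
have yQ t : 0 <= y t <= 1.
  have /andP[-> /le_trans ->//] := y01 t.
  by rewrite invf_le1 ?ltr0n// ler1n.
pose x : T -> R := fun t => if t is inl q then
  if q == q0 then 1 - \sum_(q | q != q0) y (inl q) else y (inl q) else y t.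
exists x; last first.
  by move=> [q|g]//=; rewrite !inE andbT => /= nq; rewrite ifN.
split => [q||q].
- rewrite /proportion /=; case: eqP => _; last by have /andP[] := yQ (inl q).
  rewrite subr_ge0; apply: (@le_trans _ _ (\sum_(q | q != q0) Q%:R^-1)).
    by apply: ler_sum => q' _; have /andP[] := y01 (inl q').
  rewrite sumr_const -[_^-1 *+ _]mulr_natr mulrC ler_pdivrMr ?ltr0n// mul1r ler_nat.
  by rewrite -[leqRHS]card_ord max_card.
- rewrite (bigD1 q0)//= /proportion/x eqxx.
  by rewrite [X in _ + X](eq_bigr (fun q => y (inl q))) ?subrK// => q /negbTE ->.
- exact: yQ.
Qed.

(** An independent [J] misses some proportion, because these sum to 1. If [J] had all other
    coordinates, eliminating that proportion would turn [F] into a polynomial in [J] vanishing on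
    the set, hence everywhere, against [F x0 != 0]. Here [x0] may have connection values outside
    [[0, 1]]. *)
Lemma dimension_hsbm_space_zero F x0 :
  polynomial_fun [set: T] F -> \sum_q proportion x0 q = 1 -> F x0 != 0 ->
  (dimension [set th | @hsbm_space R Q m th /\ F th = 0%R]%classic
     < dimension (@hsbm_space R Q m))%N.
Proof.
move=> polyF x0_1 Fx0; apply: leq_trans dimension_hsbm_space.
have cT := card_hsbm_coord; have cG := card_group_index_gt0.
apply: dimension_lt => [|J indJ]; first by rewrite cT; lia.
have [Jinl|] := boolP [forall q : 'I_Q, inl q \in J].
  suff /eqP : \sum_(q < Q) (0 : R) - 1 = 0 by rewrite big1// sub0r oppr_eq0 oner_eq0.
  apply: (algebraically_independent_eq0 indJ
    (F := fun x : T -> R => \sum_q x (inl q) - 1) _ _ (fun=> 0)).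
  - apply: polynomial_funB; last exact: polynomial_fun_cst.
    apply: polynomial_fun_sum => q _; apply: polynomial_fun_coord.
    exact: (forallP Jinl).
  - by move=> x [[_ + _] _]; rewrite /proportion => ->; rewrite subrr.
rewrite negb_forall => /existsP[q0 q0J].
have JD : J \subset [set: T] :\ inl q0.
  by apply/fintype.subsetP => t tJ; rewrite !inE andbT; apply: contraNneq q0J => <-.
have cD : #|[set: T] :\ inl q0| = #|T|.-1.
  by have := cardsD1 (inl q0) [set: T]; rewrite inE cardsT add1n => ->.
rewrite ltn_neqAle -{2}cD subset_leq_card// andbT.
apply/eqP => cJ.
have JE : J = [set: T] :\ inl q0 by apply/eqP; rewrite eqEcard JD cD cJ leqnn.
pose rho (x : T -> R) : T -> R := fun t =>
  if t == inl q0 then 1 - \sum_(q | q != q0) x (inl q) else x t.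
have rhoE x : \sum_q proportion x q = 1 -> rho x = x.
  move=> sx; apply/funext => t; rewrite /rho; case: eqP => // ->.
  by rewrite -sx (bigD1 q0)//= addrK.
case/eqP: Fx0; rewrite -(rhoE _ x0_1).
apply: (algebraically_independent_eq0 indJ (F := fun x => F (rho x))).
  apply: polynomial_fun_comp => // t; rewrite /rho; case: eqP => [_|/eqP tn].
    apply: polynomial_funB; first exact: polynomial_fun_cst.
    apply: polynomial_fun_sum => q nq; apply: polynomial_fun_coord.
    by rewrite JE !inE andbT.
  by apply: polynomial_fun_coord; rewrite JE !inE tn.
by move=> x [[_ sx _] Fx]; rewrite rhoE.
Qed.

Section FixedProportions.
Variables (p : 'I_Q -> R).
Hypotheses (p_ge0 : forall q, 0 <= p q) (p_sum1 : \sum_q p q = 1).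

Lemma dimension_hsbm_space_fixed :
  (#|{: group_index Q m}| <= dimension (@hsbm_space_fixed R Q m p))%N.
Proof.
have inrI : injective (@inr 'I_Q (group_index Q m)) by move=> ? ? [].
rewrite -(card_imset _ inrI).
apply/leq_dimension/(@algebraically_independent_box _ _ _ _ 1).
  by rewrite ltr01 lexx.
move=> y y01.
exists (fun t : T => if t is inl q then p q else y t).
  by split => //; split => [q||q]; [exact: p_ge0|exact: p_sum1|exact: y01].
by move=> _ /imsetP[g _ ->].
Qed.

(** The same elimination, of all proportions at once: an independent [J] contains none of them,
    since each is constant on the set. *)
Lemma dimension_hsbm_space_fixed_zero F x0 :
  polynomial_fun [set: T] F -> proportion x0 =1 p -> F x0 != 0 ->
  (dimension [set th | hsbm_space_fixed p th /\ F th = 0%R]%classic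
     < dimension (@hsbm_space_fixed R Q m p))%N.
Proof.
move=> polyF x0p Fx0; apply: leq_trans dimension_hsbm_space_fixed.
apply: dimension_lt => [|J indJ]; first exact: card_group_index_gt0.
have inrI : injective (@inr 'I_Q (group_index Q m)) by move=> ? ? [].
have inlJ q : inl q \notin J.
  apply/negP => qJ.
  suff /eqP : p q + 1 - p q = 0 by rewrite addrC addKr oner_eq0.
  apply: (algebraically_independent_eq0 indJ
    (F := fun x : T -> R => x (inl q) - p q) _ _ (fun=> p q + 1)).
  - by apply: polynomial_funB; [exact: polynomial_fun_coord|exact: polynomial_fun_cst].
  - by move=> x [[_ +] _] => /(_ q); rewrite /proportion => ->; rewrite subrr.
have JD : J \subset [set inr g | g : group_index Q m].
  apply/fintype.subsetP => -[q|g] tJ; first by rewrite (negbTE (inlJ q)) in tJ.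
  exact: imset_f.
rewrite ltn_neqAle -{2}(card_imset _ inrI) subset_leq_card// andbT.
apply/eqP => cJ.
have JE : J = [set inr g | g : group_index Q m].
  by apply/eqP; rewrite eqEcard JD (card_imset _ inrI) cJ leqnn.
pose rho (x : T -> R) : T -> R := fun t => if t is inl q then p q else x t.
have rhoE x : proportion x =1 p -> rho x = x.
  by move=> xp; apply/funext => -[q|g]//=; rewrite -xp.
case/eqP: Fx0; rewrite -(rhoE _ x0p).
apply: (algebraically_independent_eq0 indJ (F := fun x => F (rho x))).
  apply: polynomial_fun_comp => // -[q|g]; first exact: polynomial_fun_cst.
  by apply: polynomial_fun_coord; rewrite JE imset_f.
by move=> x [[_ xp] Fx]; rewrite rhoE.
Qed.

End FixedProportions.
End HsbmDimension.

(** * Means over independent draws of groups *)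

Section IteratedMean.
Context (R : realType) (Q : nat) (p : 'I_Q -> R).
Implicit Types (f g : seq 'I_Q -> R).

(* The mean of f s for s a sequence of k independent draws from p. *)
Fixpoint iterated_mean (k : nat) (f : seq 'I_Q -> R) : R :=
  if k is k'.+1 then \sum_q p q * iterated_mean k' (fun s => f (q :: s))
  else f [::].

Lemma eq_iterated_mean k f g : (forall s, size s = k -> f s = g s) ->
  iterated_mean k f = iterated_mean k g.
Proof.
elim: k f g => [|k IH] f g fg /=; first exact: fg.
apply: eq_bigr => q _; congr (_ * _); apply: IH => s ss.
by apply: fg; rewrite /= ss.
Qed.

Lemma iterated_meanD a b f : iterated_mean (a + b) f =
  iterated_mean a (fun s => iterated_mean b (fun t => f (s ++ t))).
Proof.
by elim: a f => [|a IH] f //=; apply: eq_bigr => q _; rewrite IH.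
Qed.

Lemma iterated_meanZ c k f :
  iterated_mean k (fun s => c * f s) = c * iterated_mean k f.
Proof.
elim: k f => [|k IH] f //=; rewrite mulr_sumr; apply: eq_bigr => q _.
by rewrite IH mulrCA.
Qed.

Lemma iterated_mean_cst k c : \sum_q p q = 1 -> iterated_mean k (fun=> c) = c.
Proof.
by move=> p1; elim: k => //= k ->; rewrite -mulr_suml p1 mul1r.
Qed.

Lemma iterated_mean_prod (x : 'I_Q -> R) k :
  iterated_mean k (fun s => \prod_(q <- s) x q) = (\sum_q p q * x q) ^+ k.
Proof.
elim: k => [|k IH] /=; first by rewrite big_nil.
rewrite exprS mulr_suml; apply: eq_bigr => q _; rewrite -mulrA -IH.
congr (_ * _); rewrite -iterated_meanZ; apply: eq_iterated_mean => s _.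
by rewrite big_cons.
Qed.

Lemma iterated_mean_tuple k f : iterated_mean k f =
  \sum_(w : k.-tuple 'I_Q) (\prod_(q <- w) p q) * f w.
Proof.
elim: k f => [|k IH] f /=.
  rewrite (big_pred1 [tuple]); first by rewrite big_nil mul1r.
  by move=> w /=; rewrite [w]tuple0; apply/esym/eqP/val_inj.
rewrite (reindex (fun u : 'I_Q * k.-tuple 'I_Q => [tuple of u.1 :: u.2])) /=.
  rewrite -(pair_big xpredT xpredT (fun q (w : k.-tuple 'I_Q) =>
    (\prod_(q' <- q :: w) p q') * f (q :: w))) /=.
  apply: eq_bigr => q _; rewrite IH mulr_sumr; apply: eq_bigr => w _.
  by rewrite big_cons mulrA.
exists (fun w => (thead w, [tuple of behead w])) => [[q w] _|w _] /=.
  by congr (_, _); apply/val_inj.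
by rewrite -tuple_eta.
Qed.

(** Read in the order of the nodes, the latent groups are [n] independent draws; sums over [z]
    become means that [iterated_meanD] splits. *)
Lemma iterated_mean_ffun n f :
  \sum_(z : {ffun 'I_n -> 'I_Q}) (\prod_i p (z i)) * f [seq z i | i <- enum 'I_n] =
  iterated_mean n f.
Proof.
rewrite iterated_mean_tuple.
rewrite (reindex (fun w : n.-tuple 'I_Q => [ffun i => tnth w i])) /=.
  apply: eq_bigr => w _.
  have -> : [seq [ffun i => tnth w i] i | i <- enum 'I_n] = w.
    rewrite -[RHS]map_tnth_enum; apply: eq_map => i; exact: ffunE.
  rewrite big_tuple; congr (_ * _).
  by apply: eq_bigr => i _; rewrite ffunE.
exists (fun z => [tuple z i | i < n]) => [w _|z _].
  by apply: eq_from_tnth => i; rewrite tnth_mktuple ffunE.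
by apply/ffunP => i; rewrite ffunE tnth_mktuple.
Qed.

End IteratedMean.

(** * Joint probabilities of hyperedges that share a core *)

Section Moments.
Context (R : realType) (Q m : nat).
Implicit Types (th : hsbm_param R Q m) (s : seq 'I_Q) (M : bitseq).

(** The value 0 at other lengths is a default that spares length proofs for concatenations and
    masks. *)
Definition seq_connection th s : R :=
  oapp (connection th) 0 (insub s : option (m.-tuple 'I_Q)).

Lemma seq_connection_tuple th (q : m.-tuple 'I_Q) :
  seq_connection th q = connection th q.
Proof. by rewrite /seq_connection valK. Qed.

Lemma perm_seq_connection th s s' :
  perm_eq s s' -> seq_connection th s = seq_connection th s'.
Proof.
move=> ss'; rewrite /seq_connection.
have [sm|sm] := boolP (size s == m); last first.
  by rewrite !insubN // -(perm_size ss').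
have s'm : size s' == m by rewrite -(perm_size ss').
rewrite !insubT /= /connection; congr (th (inr _)); apply/val_inj/val_inj => /=.
exact/perm_sort_leP.
Qed.

(* The conditional probability of a hyperedge given that some of its nodes have
   the groups s. *)
Definition partial_connection th s : R :=
  iterated_mean (proportion th) (m - size s) (fun t => seq_connection th (s ++ t)).

Lemma partial_connection_tuple th (q : m.-tuple 'I_Q) :
  partial_connection th q = connection th q.
Proof. by rewrite /partial_connection size_tuple subnn /= cats0 seq_connection_tuple. Qed.

(* The probability of the presence of hyperedges sharing r nodes: the one
   associated with M contains, among these nodes, those selected by M, and
   m - |M| nodes of its own. *)
Definition moment th (r : nat) (Ms : seq bitseq) : R :=
  iterated_mean (proportion th) r
    (fun s => \prod_(M <- Ms) partial_connection th (mask M s)).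

Definition own_size M := (m - count id M)%N.

(** The core consists of the nodes [0, ..., r - 1]; the nodes outside it are numbered from [o]
    on. *)
Definition nodes_of (r o : nat) M : seq nat := mask M (iota 0 r) ++ iota o (own_size M).

Fixpoint nodes_list (r o : nat) (Ms : seq bitseq) : seq (seq nat) :=
  if Ms is M :: Ms' then nodes_of r o M :: nodes_list r (o + own_size M) Ms' else [::].

(** Induction on [Ms], with [pre] the groups drawn so far. The own nodes of the first hyperedge come
    next and belong to no later one, so the mean factors; surplus draws have no effect as the
    proportions sum to 1. *)
Lemma moment_nodes_list th q0 r k (pre : seq 'I_Q) Ms :
  \sum_q proportion th q = 1 -> (r <= size pre)%N ->
  all (fun M => size M == r) Ms -> (\sum_(M <- Ms) own_size M <= k)%N ->
  iterated_mean (proportion th) k (fun t =>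
    \prod_(e <- nodes_list r (size pre) Ms)
      seq_connection th [seq nth q0 (pre ++ t) i | i <- e]) =
  \prod_(M <- Ms) partial_connection th (mask M (take r pre)).
Proof.
move=> th1; elim: Ms k pre => [|M Ms IH] k pre rpre /=.
  move=> _ _; rewrite big_nil -[RHS](iterated_mean_cst k _ th1).
  by apply: eq_iterated_mean => s _; rewrite big_nil.
move=> /andP[/eqP Mr Msr]; rewrite big_cons => Mk.
have -> : k = (own_size M + (k - own_size M))%N.
  by rewrite subnKC// (leq_trans _ Mk)// leq_addr.
rewrite iterated_meanD big_cons.
have takeE : [seq nth q0 pre i | i <- iota 0 r] = take r pre.
  rewrite -[in RHS](mkseq_nth q0 pre) /mkseq -map_take take_iota.
  by congr (map _ (iota _ _)); apply/esym/minn_idPl.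
(* Once [u] is drawn, the induction hypothesis for the prefix [pre ++ u] gives the mean over the
   later draws, which does not depend on [u]. *)
transitivity (iterated_mean (proportion th) (own_size M) (fun u =>
   (\prod_(M0 <- Ms) partial_connection th (mask M0 (take r pre))) *
   seq_connection th (mask M (take r pre) ++ u))).
  apply: eq_iterated_mean => u su.
  have := IH (k - own_size M)%N (pre ++ u); rewrite takel_cat// mulrC => <- //.
  - rewrite -iterated_meanZ; apply: eq_iterated_mean => t st.
    rewrite big_cons size_cat su catA; congr (seq_connection th _ * _).
    rewrite map_cat map_mask; congr (mask _ _ ++ _).
      rewrite -takeE; apply/eq_in_map => i; rewrite mem_iota add0n => /= ir.
      by rewrite -catA nth_cat (leq_trans ir).
    apply: (@eq_from_nth _ q0); rewrite size_map size_iota ?su// => i iM.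
    rewrite (nth_map 0%N) ?size_iota// nth_iota// -catA nth_cat.
    by rewrite ltnNge leq_addr/= addKn nth_cat su iM.
  - by rewrite size_cat (leq_trans rpre)// leq_addr.
  - by rewrite leq_subRL ?(leq_trans _ Mk)// leq_addr.
rewrite iterated_meanZ mulrC; congr (_ * _).
rewrite /partial_connection size_mask ?size_takel//; exact: Mr.
Qed.

End Moments.

(** * Moments as functions of the law *)

Section Observation.
Context (R : realType) (Q m n : nat).
Implicit Types (th : hsbm_param R Q m) (z : {ffun 'I_n -> 'I_Q}) (y : hypergraph n m).

(** Given [z], the sum over [y] factors over hyperedges: one outside [L] contributes 1, one in [L]
    its probability. A repeated one would break this, as [y e] is idempotent and a probability need
    not be. *)
Lemma hsbm_law_moment th (L : seq (hyperedge n m)) : uniq L ->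
  \sum_y hsbm_law th y * \prod_(e <- L) (y e)%:R =
  \sum_z latent_pmf th z * \prod_(e <- L) connection th (edge_groups z e).
Proof.
move=> uL; rewrite /hsbm_law.
under eq_bigr => y _ do rewrite mulr_suml.
rewrite exchange_big /=; apply: eq_bigr => z _.
under eq_bigr => y _ do rewrite -mulrA.
rewrite -mulr_sumr; congr (_ * _).
pose f e (b : bool) := bernoulli_pmf (connection th (edge_groups z e)) b *
  (if e \in L then b%:R else 1).
transitivity (\sum_(y : hypergraph n m) \prod_e f e (y e)).
  apply: eq_bigr => y _; rewrite big_split /=; congr (_ * _).
  by rewrite (big_uniq _ uL) big_mkcond.
rewrite -bigA_distr_bigA/=.
rewrite [RHS](big_uniq _ uL) [RHS]big_mkcond /=; apply: eq_bigr => e _.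
rewrite /f big_bool /bernoulli_pmf; case: ifP => _; first by rewrite /= mulr1 mulr0 addr0.
by rewrite /= !mulr1 addrC subrK.
Qed.

Definition node_set (e : seq nat) : {set 'I_n} := [set i : 'I_n | val i \in e].

Lemma enum_node_set e : uniq e -> all (fun i => i < n)%N e ->
  perm_eq [seq val i | i <- enum (node_set e)] e.
Proof.
move=> ue /allP en; apply: uniq_perm => //.
  by rewrite map_inj_uniq ?enum_uniq//; exact: val_inj.
move=> i; apply/mapP/idP => [[j + ->]|ie]; first by rewrite mem_enum inE.
by exists (Ordinal (en i ie)) => //; rewrite mem_enum inE.
Qed.

Lemma card_node_set e : uniq e -> all (fun i => i < n)%N e -> #|node_set e| = size e.
Proof. by move=> ue en; rewrite cardE -(size_map val) (perm_size (enum_node_set ue en)). Qed.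

Lemma hyperedges_of_sets (As : seq {set 'I_n}) :
  all (fun A : {set 'I_n} => #|A| == m) As ->
  exists L : seq (hyperedge n m), map val L = As.
Proof.
elim: As => [|A As IH] /=; first by exists [::].
move=> /andP[Am /IH[L LA]]; exists (exist _ A Am :: L) => /=.
by rewrite LA.
Qed.

Lemma size_nodes_of r o M : size M = r -> (count id M <= m)%N ->
  size (nodes_of m r o M) = m.
Proof.
move=> Mr cM; rewrite size_cat size_mask ?size_iota//.
by rewrite /own_size subnKC.
Qed.

Lemma nodes_of_lt r o M i : (r <= o)%N -> i \in nodes_of m r o M ->
  (i < o + own_size m M)%N.
Proof.
move=> ro; rewrite mem_cat => /orP[/mem_mask|]; rewrite mem_iota; last by case/andP.
by move=> /andP[_ ir]; rewrite ltn_addr// (leq_trans ir).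
Qed.

Lemma uniq_nodes_of r o M : (r <= o)%N -> uniq (nodes_of m r o M).
Proof.
move=> ro; rewrite cat_uniq mask_uniq ?iota_uniq// andbT /=.
apply/hasPn => i; rewrite mem_iota => /andP[oi _].
by apply/negP => /mem_mask; rewrite mem_iota add0n /= ltnNge (leq_trans ro).
Qed.

Lemma nodes_listP r o Ms e : (r <= o)%N -> e \in nodes_list m r o Ms ->
  exists2 o', (o <= o')%N & exists2 M, M \in Ms &
    e = nodes_of m r o' M /\ (o' + own_size m M <= o + \sum_(M <- Ms) own_size m M)%N.
Proof.
elim: Ms o => //= M Ms IH o ro; rewrite inE big_cons => /orP[/eqP->|].
  by exists o => //; exists M; rewrite ?mem_head//; split=> //; rewrite addnA leq_addr.
move=> /IH[|o' oo' [M' M'Ms [-> le]]]; first by rewrite (leq_trans ro)// leq_addr.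
exists o'; first by rewrite (leq_trans _ oo')// leq_addr.
by exists M'; rewrite ?inE ?M'Ms ?orbT//; split=> //; rewrite addnA.
Qed.

(* Hyperedges are distinguished by the nodes of their own, and only the first
   one is allowed to have none. *)
Lemma uniq_nodes_list r o Ms : (r <= o)%N ->
  (o + \sum_(M <- Ms) own_size m M <= n)%N ->
  all (fun M => count id M < m)%N (behead Ms) ->
  uniq (map node_set (nodes_list m r o Ms)).
Proof.
elim: Ms o => //= M Ms IH o ro; rewrite big_cons addnA => on cMs.
have ro' : (r <= o + own_size m M)%N by rewrite (leq_trans ro)// leq_addr.
rewrite IH//; last first.
  by apply/allP => M' /mem_behead/(allP cMs).
rewrite andbT; apply/mapP => -[_ /(nodes_listP ro')[o' oo' [M' M'Ms [-> le]]]].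
have cM' := allP cMs _ M'Ms.
have lt0 : (0 < own_size m M')%N by rewrite subn_gt0.
have o'n : (o' < n)%N.
  apply: leq_trans on; apply: leq_trans le; by rewrite -[X in (X < _)%N]addn0 ltn_add2l.
(* The first own node [o'] of a later hyperedge lies beyond all nodes of the first one. *)
move=> /setP/(_ (Ordinal o'n)); rewrite !inE /= => eo'.
have /(nodes_of_lt ro) : o' \in nodes_of m r o M.
  by rewrite eo' mem_cat mem_iota leqnn -[X in (X < _)%N]addn0 ltn_add2l lt0 orbT.
by rewrite ltnNge oo'.
Qed.

(** Once realized on ['I_n], the hyperedges of [nodes_list] are all present with probability
    [moment th r Ms], an expectation under the law. *)
Lemma eq_moment th th' r Ms :
  (forall y : hypergraph n m, hsbm_law th y = hsbm_law th' y) ->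
  \sum_q proportion th q = 1 -> \sum_q proportion th' q = 1 -> (0 < Q)%N ->
  all (fun M => (size M == r) && (count id M <= m)%N) Ms ->
  all (fun M => count id M < m)%N (behead Ms) ->
  (r + \sum_(M <- Ms) own_size m M <= n)%N ->
  moment th r Ms = moment th' r Ms.
Proof.
move=> law th1 th1' Q0 Msr cMs rn.
have sMs : all (fun M => size M == r) Ms.
  by apply: sub_all Msr => M /andP[].
pose es := nodes_list m r r Ms.
have esP e : e \in es -> [/\ uniq e, all (fun i => i < n)%N e & size e = m].
  move=> /(nodes_listP (leqnn r))[o ro [M MMs [-> le]]].
  have /andP[/eqP Mr cM] := allP Msr _ MMs.
  split; [exact: uniq_nodes_of| |exact: size_nodes_of].
  by apply/allP => i /(nodes_of_lt ro) /leq_trans; apply; exact: leq_trans rn.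
have [|L LE] := @hyperedges_of_sets (map node_set es).
  by rewrite all_map; apply/allP => e /esP[ue en se] /=; rewrite card_node_set// se.
have uL : uniq L.
  by apply: (@map_uniq _ _ val); rewrite LE uniq_nodes_list.
suff H th0 : \sum_q proportion th0 q = 1 ->
    moment th0 r Ms = \sum_y hsbm_law th0 y * \prod_(e <- L) (y e)%:R.
  by rewrite !H//; apply: eq_bigr => y _; rewrite law.
move=> th01; rewrite hsbm_law_moment//.
pose q0 := Ordinal Q0.
transitivity (iterated_mean (proportion th0) n (fun s =>
    \prod_(e <- es) seq_connection th0 [seq nth q0 s i | i <- e])).
  have -> : n = (r + (n - r))%N by rewrite subnKC// (leq_trans _ rn)// leq_addr.
  rewrite iterated_meanD; apply: eq_iterated_mean => s sr.
  have := @moment_nodes_list _ _ _ th0 q0 r (n - r) s Ms.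
  rewrite sr take_oversize ?sr// => -> //.
  by rewrite leq_subRL// (leq_trans _ rn)// leq_addr.
rewrite -iterated_mean_ffun; apply: eq_bigr => z _; congr (_ * _).
transitivity (\prod_(A <- map val L) seq_connection th0 [seq z i | i <- enum A]).
  rewrite LE big_map; apply: eq_big_seq => e /esP[ue en se].
  apply: perm_seq_connection; rewrite perm_sym.
  apply: perm_trans (perm_map _ (enum_node_set ue en)); rewrite -map_comp.
  rewrite [X in perm_eq _ X](@eq_map _ _ _ z)// => i /=.
  by rewrite (nth_map i) ?size_enum_ord// nth_ord_enum.
by rewrite big_map; apply: eq_bigr => e _; rewrite -seq_connection_tuple.
Qed.

End Observation.

(** * Sums over tuples and Vandermonde matrices *)

Section TupleSums.

Lemma bigA_distr_tuple (R : comNzRingType) (A : finType) (r : nat) (F : 'I_r -> A -> R) :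
  \sum_(k : r.-tuple A) \prod_t F t (tnth k t) = \prod_t \sum_a F t a.
Proof.
rewrite bigA_distr_bigA /= (reindex (fun k : r.-tuple A => [ffun t => tnth k t])) /=.
  by apply: eq_bigr => k _; apply: eq_bigr => t _; rewrite ffunE.
exists (fun z => [tuple z t | t < r]) => [w _|z _].
  by apply: eq_from_tnth => i; rewrite tnth_mktuple ffunE.
by apply/ffunP => i; rewrite ffunE tnth_mktuple.
Qed.

Lemma Vandermonde_unitmx (F : fieldType) (k : nat) (x : 'I_k -> F) :
  injective x -> Vandermonde k (\row_i x i) \in unitmx.
Proof.
move=> x_inj; rewrite unitmxE det_Vandermonde unitfE.
apply/prodf_neq0 => i _; apply/prodf_neq0 => j ij; rewrite !mxE subr_eq0.
by apply: contraTneq ij => /x_inj ->; rewrite ltnn.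
Qed.

End TupleSums.

(** * Test hyperedges and the exponents they produce *)

Section TestMasks.
Context (Q m : nat).
Implicit Types (k : seq nat) (l : nat).

(* Both masks select a proper subset of the positions when there are at least
   two positions, and together they select the positions i such that l < k_i. *)
Definition level_masks k l : seq bitseq :=
  if k is a :: k' then
    [:: (l < a)%N :: nseq (size k') false; false :: [seq (l < i)%N | i <- k']]
  else [::].

Definition test_masks k : seq bitseq := flatten [seq level_masks k l | l <- iota 0 Q.-1].

Lemma size_test_masks k : (size (test_masks k) <= 2 * Q.-1)%N.
Proof.
rewrite /test_masks -[X in (_ <= _ * X)%N](size_iota 0).
elim: (iota 0 Q.-1) => //= l s IH; rewrite size_cat mulnS leq_add//.
by case: k {IH}.
Qed.

Lemma test_masksP k M : M \in test_masks k ->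
  size M = size k /\ ((1 < size k)%N -> (count id M < size k)%N).
Proof.
move=> /flatten_mapP[l _]; case: k => // a k /=; rewrite !inE => /orP[]/eqP -> /=.
  by rewrite size_nseq count_nseq mul0n addn0; split=> // k0; case: (l < a)%N.
rewrite size_map add0n; split=> // _.
by rewrite ltnS -[X in (_ <= X)%N](size_map (fun i => l < i)%N) count_size.
Qed.

Lemma sum_own_size_test_masks k :
  (\sum_(M <- test_masks k) own_size m M <= 2 * Q.-1 * m)%N.
Proof.
apply: leq_trans (leq_mul (size_test_masks k) (leqnn m)).
elim: (test_masks k) => [|M Ms IH]; first by rewrite big_nil.
by rewrite big_cons /= mulSn leq_add// leq_subr.
Qed.

(** Position [t] is selected at the levels [l < k_t], and the entries of [k] are at most [Q - 1]; so
    exactly [k_t] masks select it. *)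
Lemma prod_test_masks (R : comNzRingType) (x : 'I_Q -> R) r (k w : r.-tuple 'I_Q) :
  \prod_(M <- test_masks (map val k)) \prod_(q <- mask M w) x q =
  \prod_t x (tnth w t) ^+ tnth k t.
Proof.
rewrite big_flatten /= big_map.
transitivity (\prod_(l <- iota 0 Q.-1)
    \prod_(q <- mask [seq (l < i)%N | i <- map val k] w) x q).
  apply: eq_bigr => l _; case: r k w => [|r] k w.
    by rewrite !tuple0 /= !big_nil.
  case/tupleP: k => a k; case/tupleP: w => b w /=.
  rewrite !big_cons big_nil mulr1 !mask_cons mask_false cats0 /= -big_cat.
  by rewrite -mask_cons.
have kQ i : i \in map val k -> (i <= Q.-1)%N.
  by move=> /mapP[a _ ->]; rewrite -ltnS (ltn_predK (ltn_ord a)) ltn_ord.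
transitivity (\prod_(u <- zip (map val k) w) x u.2 ^+ u.1).
  elim: r k w kQ => [|r IH] k w kQ.
    by rewrite (tuple0 k) (tuple0 w) /= big_nil big1 ?big_nil// => l _; rewrite big_nil.
  case/tupleP: k kQ => a k kQ; case/tupleP: w => b w.
  have maskE l : \prod_(q <- mask [seq (l < i)%N | i <- map val (a :: k)] (b :: w)) x q =
      (if (l < a)%N then x b else 1) *
      \prod_(q <- mask [seq (l < i)%N | i <- map val k] w) x q.
    rewrite mask_cons big_cat; congr (_ * _).
    by case: (l < a)%N; rewrite /= ?big_seq1 ?big_nil.
  rewrite [RHS]big_cons /= -IH => [|i ik]; last by rewrite kQ// inE ik orbT.
  under eq_bigr => l _ do rewrite maskE.
  rewrite big_split /=; congr (_ * _).
  have aQ : (a <= Q.-1)%N by rewrite kQ// mem_head.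
  rewrite -(subnKC aQ) iotaD big_cat /= [X in _ * X]big1_seq ?mulr1; last first.
    by move=> l; rewrite mem_iota add0n /= => /andP[al _]; rewrite ltnNge al.
  rewrite big_seq_cond (eq_bigr (fun=> x b)) => [|l]; last first.
    by rewrite mem_iota add0n andbT /= => ->.
  by rewrite -big_seq_cond big_const_seq count_predT size_iota iter_mulr_1.
have -> : zip (map val k) w = [seq (val (tnth k t), tnth w t) | t <- enum 'I_r].
  by rewrite -[in LHS](map_tnth_enum k) -[in LHS](map_tnth_enum w) -map_comp zip_map.
by rewrite big_map big_enum.
Qed.

End TestMasks.

(** * Test matrix, and its inverse for product connections *)

Section TestMatrix.
Context (R : realType) (Q m : nat).
Implicit Types (th : hsbm_param R Q m).

Definition test_fun th (k : seq nat) (w : seq 'I_Q) : R :=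
  \prod_(M <- test_masks Q k) partial_connection th (mask M w).

Definition test_mx th r : 'M[R]_#|{: r.-tuple 'I_Q}| :=
  \matrix_(i, j) test_fun th (map val (enum_val i : r.-tuple 'I_Q))
                             (enum_val j : r.-tuple 'I_Q).

Section ProductConnection.
Variables (p x : 'I_Q -> R).

(** A point at which polynomials are evaluated; its connection values may exceed 1. *)
Definition product_param : hsbm_param R Q m := fun t =>
  match t with inl q => p q | inr g => \prod_(q <- val g) x q end.

Lemma seq_connection_product s : size s = m ->
  seq_connection product_param s = \prod_(q <- s) x q.
Proof.
move=> sm; have sm' : size s == m by apply/eqP.
rewrite -[s]/(val (Tuple sm')) seq_connection_tuple /connection /=.
by apply: perm_big; rewrite perm_sort.
Qed.

Lemma partial_connection_product s : (size s <= m)%N ->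
  partial_connection product_param s =
  (\sum_q p q * x q) ^+ (m - size s) * \prod_(q <- s) x q.
Proof.
move=> sm; rewrite -iterated_mean_prod mulrC -iterated_meanZ.
apply: eq_iterated_mean => t st.
by rewrite seq_connection_product ?big_cat// size_cat st subnKC.
Qed.

Hypotheses (x_inj : injective x) (mean_neq0 : \sum_q p q * x q != 0).

Lemma test_mx_product_unit r : (r <= m)%N -> test_mx product_param r \in unitmx.
Proof.
move=> rm.
pose c k := \prod_(M <- test_masks Q k) (\sum_q p q * x q) ^+ (m - count id M).
have c_neq0 k : c k != 0.
  by rewrite prodf_seq_neq0; apply/allP => M _; rewrite implyTb expf_neq0.
have testE (k w : r.-tuple 'I_Q) : test_fun product_param (map val k) w =
    c (map val k) * \prod_t x (tnth w t) ^+ tnth k t.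
  rewrite -prod_test_masks -big_split; apply: eq_big_seq => M /test_masksP[sM _].
  have sM' : size M = size w by rewrite sM size_map !size_tuple.
  rewrite /= partial_connection_product size_mask// (leq_trans _ rm)//.
  by rewrite (leq_trans (count_size _ _))// sM' size_tuple.
pose V := Vandermonde Q (\row_q x q).
have VK : invmx V *m V = 1%:M by rewrite mulVmx// Vandermonde_unitmx.
(* The tensor power of [invmx V], with the column of [k] divided by [c k]. *)
pose N : 'M[R]_#|{: r.-tuple 'I_Q}| := \matrix_(i, j)
  ((c (map val (enum_val j : r.-tuple 'I_Q)))^-1 *
   \prod_t invmx V (tnth (enum_val i) t) (tnth (enum_val j) t)).
suff /mulmx1_unit[] : N *m test_mx product_param r = 1%:M by [].
apply/matrixP => i j; rewrite !mxE.
under eq_bigr => h _ do rewrite !mxE testE mulrACA mulVf// mul1r -big_split /=.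
rewrite -(big_enum_val (fun k : r.-tuple 'I_Q => \prod_t
  (invmx V (tnth (enum_val i : r.-tuple 'I_Q) t) (tnth k t) *
     x (tnth (enum_val j : r.-tuple 'I_Q) t) ^+ tnth k t))) /=.
rewrite (eq_bigl xpredT)// (bigA_distr_tuple (fun t a =>
  invmx V (tnth (enum_val i : r.-tuple 'I_Q) t) a *
     x (tnth (enum_val j : r.-tuple 'I_Q) t) ^+ a)).
have VKE (a b : 'I_Q) : \sum_c invmx V a c * x b ^+ c = (a == b)%:R.
  have := congr1 (fun A : 'M_Q => A a b) VK; rewrite !mxE => <-.
  by apply: eq_bigr => d _; rewrite !mxE.
under eq_bigr => t _ do rewrite VKE.
rewrite -(inj_eq enum_val_inj); case: eqP => [->|nij].
  by rewrite big1// => t _; rewrite eqxx.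
have [t /negbTE tij|tij] := pickP (fun t => tnth (enum_val i : r.-tuple 'I_Q) t
    != tnth (enum_val j : r.-tuple 'I_Q) t).
  by rewrite (bigD1 t)//= tij mul0r.
by case: nij; apply: eq_from_tnth => t; apply/eqP; have := tij t => /negbFE.
Qed.
End ProductConnection.
End TestMatrix.

(** * The polynomial that defines the exceptional parameters *)

Section Genericity.
Context (R : realType) (Q m : nat).
Implicit Types (th : hsbm_param R Q m).
Let T : finType := hsbm_coord Q m.

Definition generic_fun th : R :=
  (\prod_q proportion th q) *
  ((\prod_q \prod_(q' | q' != q)
     (partial_connection th [:: q] - partial_connection th [:: q'])) *
   \prod_(2 <= r < m.+1) \det (test_mx th r)).

Lemma polynomial_fun_iterated_mean k (f : hsbm_param R Q m -> seq 'I_Q -> R) :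
  (forall s, polynomial_fun [set: T] (fun th : T -> R => f th s)) ->
  polynomial_fun [set: T] (fun th : T -> R => iterated_mean (proportion th) k (f th)).
Proof.
elim: k f => [|k IH] f hf /=; first exact: hf.
apply: polynomial_fun_sum => q _; apply: polynomial_funM.
  by apply: polynomial_fun_coord; rewrite inE.
by apply: (IH (fun th s => f th (q :: s))) => s; exact: hf.
Qed.

Lemma polynomial_fun_partial_connection s :
  polynomial_fun [set: T] (fun th : T -> R => partial_connection (th : hsbm_param R Q m) s).
Proof.
apply: (@polynomial_fun_iterated_mean _ (fun th t => seq_connection th (s ++ t))) => t.
rewrite /seq_connection; case: insub => [q|] /=; last exact: polynomial_fun_cst.
by apply: polynomial_fun_coord; rewrite inE.
Qed.

Lemma polynomial_fun_generic_fun : polynomial_fun [set: T] generic_fun.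
Proof.
apply: polynomial_funM.
  by apply: polynomial_fun_prod => q _; apply: polynomial_fun_coord; rewrite inE.
apply: polynomial_funM.
  apply: polynomial_fun_prod => q _; apply: polynomial_fun_prod => q' _.
  by apply: polynomial_funB; exact: polynomial_fun_partial_connection.
apply: polynomial_fun_prod => r _; apply: polynomial_fun_det => i j.
have -> : (fun th : T -> R => test_mx (th : hsbm_param R Q m) r i j) =
  (fun th => \prod_(M <- test_masks Q (map val (enum_val i : r.-tuple 'I_Q)))
    partial_connection th (mask M (enum_val j : r.-tuple 'I_Q))).
  by apply/funext => th; rewrite mxE.
by apply: polynomial_fun_prod => M _; exact: polynomial_fun_partial_connection.
Qed.

(** The values [q + 1] are distinct and their mean [mu] is positive, so the
    [d(q) = mu ^ (m - 1) * (q + 1)] are distinct and [test_mx_product_unit] applies. *)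
Lemma generic_fun_neq0 (p : 'I_Q -> R) : (0 < m)%N -> (0 < Q)%N ->
  (forall q, 0 < p q) ->
  generic_fun (@product_param R Q m p (fun q => (val q).+1%:R)) != 0.
Proof.
move=> m0 Q0 p0; set x := fun q : 'I_Q => (val q).+1%:R : R.
have x_inj : injective x by move=> q q' /eqP; rewrite eqr_nat eqSS => /eqP/val_inj.
have mean_gt0 : 0 < \sum_q p q * x q.
  rewrite (bigD1 (Ordinal Q0))//= ltr_pwDl// ?mulr_gt0 ?ltr0Sn//.
  by apply: sumr_ge0 => q _; rewrite mulr_ge0 ?ler0n// ltW.
rewrite !mulf_neq0//.
- by apply/prodf_neq0 => q _; rewrite gt_eqF.
- apply/prodf_neq0 => q _; apply/prodf_neq0 => q' nq.
  rewrite !partial_connection_product// !big_seq1 -mulrBr mulf_neq0//.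
    by rewrite expf_neq0// gt_eqF.
  by rewrite subr_eq0; apply: contra_neq nq => /x_inj.
- rewrite prodf_seq_neq0; apply/allP => r; rewrite mem_index_iota ltnS => /andP[_ rm].
  by rewrite implyTb -unitfE -unitmxE test_mx_product_unit// gt_eqF.
Qed.

Lemma generic_funP th : generic_fun th != 0 ->
  [/\ forall q, proportion th q != 0,
      injective (fun q => partial_connection th [:: q]) &
      forall r, (2 <= r <= m)%N -> test_mx th r \in unitmx].
Proof.
rewrite !mulf_eq0 !negb_or => /and3P[/prodf_neq0 pn /prodf_neq0 dn tn]; split.
- by move=> q; exact: pn.
- move=> q q' E; apply/eqP; apply: contraT => nq.
  have /prodf_neq0/(_ q') := dn q isT.
  by rewrite eq_sym nq E subrr eqxx => /(_ isT).
- move=> r r2m; rewrite unitmxE unitfE.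
  move: tn; rewrite prodf_seq_neq0 => /allP/(_ r).
  by rewrite mem_index_iota ltnS r2m => /(_ isT).
Qed.

End Genericity.

(** * Finitely supported measures determined by moments *)

Section FiniteMoments.
Context (R : fieldType) (Q : nat) (p d p' d' : 'I_Q -> R).

Lemma finite_moment_poly (N : nat) (f : {poly R}) :
  (forall k, (k < N)%N -> \sum_q p q * d q ^+ k = \sum_q p' q * d' q ^+ k) ->
  (size f <= N)%N -> \sum_q p q * f.[d q] = \sum_q p' q * f.[d' q].
Proof.
move=> mom fN.
have E (a b : 'I_Q -> R) : \sum_q a q * f.[b q] = \sum_(k < N) f`_k * \sum_q a q * b q ^+ k.
  under eq_bigr => q _ do rewrite (horner_coef_wide _ fN) mulr_sumr.
  rewrite exchange_big; apply: eq_bigr => k _; rewrite mulr_sumr.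
  by apply: eq_bigr => q _; rewrite mulrCA.
by rewrite !E; apply: eq_bigr => k _; rewrite mom.
Qed.

(** [g q0] vanishes at all atoms [d q] but [d q0]. Matching each [d q0] with some [d' q'] yields a
    permutation, and then [g] compares the weights. *)
Lemma finite_moment_unique :
  (forall q, p q != 0) -> injective d ->
  (forall k, (k < 2 * Q)%N -> \sum_q p q * d q ^+ k = \sum_q p' q * d' q ^+ k) ->
  exists s : {perm 'I_Q}, (forall q, p' q = p (s q)) /\ (forall q, d' q = d (s q)).
Proof.
move=> pn d_inj mom.
pose g q0 : {poly R} := \prod_(q | q != q0) ('X - (d q)%:P).
have size_g q0 : (size (g q0) <= Q)%N.
  apply: leq_trans (size_poly_prod_leq _ _) _; rewrite leq_subLR.
  under eq_bigr => q _ do rewrite size_XsubC.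
  rewrite sum_nat_const cardC1 card_ord.
  by case: Q q0 => [[]//|Q' _]; lia.
have g_neq0 q0 : (g q0).[d q0] != 0.
  rewrite horner_prod; apply/prodf_neq0 => q nq.
  by rewrite hornerXsubC subr_eq0; apply: contra_neq nq => /d_inj.
have g_eq0 q0 q : q != q0 -> (g q0).[d q] = 0.
  by move=> nq; rewrite horner_prod (bigD1 q)//= hornerXsubC subrr mul0r.
have atom q0 : exists q', d' q' == d q0.
  apply: contrapT => /forallNP nd.
  (* If no [d' q] equals [d q0], [h] isolates [d q0] among all atoms of both sides; its degree
     [2 * Q - 1] explains the number of moments. *)
  pose h : {poly R} := g q0 * \prod_q ('X - (d' q)%:P).
  have size_h : (size h <= 2 * Q)%N.
    apply: leq_trans (size_polyMleq _ _) _.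
    rewrite size_prod_XsubC [index_enum _]unlock -enumT size_enum_ord.
    by have := size_g q0; lia.
  have := finite_moment_poly mom size_h.
  rewrite [X in _ = X]big1 => [|q _]; last first.
    rewrite hornerM [X in _ * (_ * X)]horner_prod (bigD1 q)//=.
    by rewrite hornerXsubC subrr mul0r !mulr0.
  rewrite (bigD1 q0)//= [X in _ + X]big1 ?addr0 => [|q nq]; last first.
    by rewrite hornerM g_eq0// mul0r mulr0.
  apply/eqP; rewrite hornerM !mulf_neq0// horner_prod; apply/prodf_neq0 => q _.
  by rewrite hornerXsubC subr_eq0 eq_sym; apply/negP/nd.
pose f q := xchoose (atom q).
have fE q : d' (f q) = d q by apply/eqP/(xchooseP (atom q)).
have f_inj : injective f by move=> q q' E; apply: d_inj; rewrite -!fE E.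
pose t := perm f_inj.
have tE q : d' (t q) = d q by rewrite permE.
have d't q : d' q = d (t^-1 q)%g by rewrite -tE permKV.
exists t^-1%g; split=> // q.
have := @finite_moment_poly (2 * Q) (g (t^-1 q)%g) mom.
rewrite (bigD1 (t^-1 q)%g)//= [X in _ + X]big1 ?addr0 => [|q' nq]; last first.
  by rewrite g_eq0// mulr0.
rewrite (bigD1 q)//= -d't [X in _ + X]big1 ?addr0 => [|q' nq]; last first.
  by rewrite d't g_eq0 ?mulr0// (inj_eq perm_inj).
rewrite d't => /(_ _)/(mulIf (g_neq0 _)) -> //.
by apply: leq_trans (size_g _) _; lia.
Qed.
End FiniteMoments.

(** * Recovery of the parameter from the law *)

Section Recovery.
Context (R : realType) (Q m n : nat) (th th' : hsbm_param R Q m).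
Hypotheses (m_ge2 : (2 <= m)%N) (Q_gt0 : (0 < Q)%N) (n_large : (Q ^ 2 * m <= n)%N).
Hypotheses (law_eq : forall y : hypergraph n m, hsbm_law th y = hsbm_law th' y).
Hypotheses (sum_th : \sum_q proportion th q = 1) (sum_th' : \sum_q proportion th' q = 1).
Hypothesis (generic_th : generic_fun th != 0).

Let budget : (m + 2 * Q.-1 * m <= n)%N.
Proof.
(* Up to the factor [m], this is [1 + 2 * (Q - 1) <= Q ^ 2]. *)
apply: leq_trans n_large; rewrite -mulSn leq_mul2r; apply/orP; right.
by case: Q Q_gt0 => // q _ /=; nia.
Qed.

(** For [k] hyperedges through one common node the moment is the mean of [d(q) ^ k]; as [m >= 2],
    each has nodes of its own, so they are distinct. *)
Lemma recover_proportion : exists s : {perm 'I_Q},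
  (forall q, proportion th' q = proportion th (s q)) /\
  (forall q, partial_connection th' [:: q] = partial_connection th [:: s q]).
Proof.
have [pn d_inj _] := generic_funP generic_th.
have momE (th0 : hsbm_param R Q m) k : moment th0 1 (nseq k [:: true]) =
    \sum_q proportion th0 q * partial_connection th0 [:: q] ^+ k.
  by apply: eq_bigr => q _; rewrite big_nseq iter_mulr_1.
apply: (@finite_moment_unique _ _ (proportion th) (fun q => partial_connection th [:: q])
  (proportion th') (fun q => partial_connection th' [:: q])) => // k kQ.
rewrite -!momE.
apply: (@eq_moment _ _ _ n) => //.
- by rewrite all_nseq /= (ltnW m_ge2) orbT.
- by case: k {kQ} => //= k; rewrite all_nseq /= m_ge2 orbT.
- rewrite big_nseq iter_addn_0 /own_size /=; apply: leq_trans budget.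
  by case: m m_ge2 => // m' _; case: Q Q_gt0 kQ => // q _ kQ /=; nia.
Qed.

Section Connections.
Variable (s : {perm 'I_Q}).
Hypotheses (prop_s : forall q, proportion th' q = proportion th (s q)).
Hypotheses (deg_s : forall q, partial_connection th' [:: q] = partial_connection th [:: s q]).

Lemma recover_partial_connection r w : (r <= m)%N -> size w = r ->
  partial_connection th' w = partial_connection th (map s w).
Proof.
have [pn _ unit_th] := generic_funP generic_th.
elim/ltn_ind: r w => r IH w rm wr.
(* With an empty core, [d] is the probability of a single hyperedge. *)
have [r0|r_gt0] := posnP r.
  have -> : w = [::] by apply/nilP; rewrite /nilp wr r0.
  have := @eq_moment _ _ _ n th th' 0 [:: [::]] law_eq sum_th sum_th' Q_gt0.
  rewrite /moment /= !big_cons !big_nil !mulr1 => -> //.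
  rewrite /own_size subn0 addn0 add0n; apply: leq_trans budget; exact: leq_addr.
have [r1|r_gt1] := leqP r 1.
  have r1E : r = 1%N by apply/eqP; rewrite eqn_leq r1.
  by case: w wr => [|q [|]] //=; rewrite r1E.
have sumE (k : r.-tuple 'I_Q) :
    \sum_(u : r.-tuple 'I_Q) (\prod_(q <- u) proportion th q) *
      (partial_connection th u * test_fun th (map val k) u) =
    \sum_(u : r.-tuple 'I_Q) (\prod_(q <- u) proportion th' q) *
      (partial_connection th' u * test_fun th' (map val k) u).
  (* The full mask comes first, because its hyperedge has no own node when [r = m]. *)
  have := @eq_moment _ _ _ n th th' r (nseq r true :: test_masks Q (map val k))
    law_eq sum_th sum_th' Q_gt0.
  rewrite /moment !iterated_mean_tuple => H.
  have momE (th0 : hsbm_param R Q m) :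
      \sum_(u : r.-tuple 'I_Q) (\prod_(q <- u) proportion th0 q) *
        (partial_connection th0 u * test_fun th0 (map val k) u) =
      \sum_(u : r.-tuple 'I_Q) (\prod_(q <- u) proportion th0 q) *
        (\prod_(M <- nseq r true :: test_masks Q (map val k))
          partial_connection th0 (mask M u)).
    by apply: eq_bigr => u _; rewrite big_cons mask_true ?size_tuple.
  rewrite !momE; apply: H => /=.
  - rewrite size_nseq eqxx count_nseq mul1n rm /=.
    apply/allP => M /test_masksP[]; rewrite size_map size_tuple => -> /(_ r_gt1) cM.
    by rewrite eqxx (leq_trans (ltnW cM)).
  - apply/allP => M /test_masksP[_]; rewrite size_map size_tuple => /(_ r_gt1) cM.
    exact: leq_trans rm.
  - rewrite big_cons /own_size count_nseq mul1n addnA subnKC//.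
    by apply: leq_trans budget; rewrite leq_add2l sum_own_size_test_masks.
(* Test masks select fewer than [r] positions, so the induction hypothesis applies to each
   factor. *)
have testE (k u : r.-tuple 'I_Q) :
    test_fun th' (map val k) u = test_fun th (map val k) (map s u).
  apply: eq_big_seq => M /test_masksP[]; rewrite size_map size_tuple => Mr /(_ r_gt1) cM.
  rewrite -map_mask (IH (count id M))//; first exact: leq_trans (ltnW cM) rm.
  by rewrite size_mask ?size_tuple.
have mapK : cancel (map_tuple s : r.-tuple 'I_Q -> r.-tuple 'I_Q) (map_tuple s^-1%g).
  move=> u; apply/val_inj; rewrite /= -map_comp -[RHS]map_id.
  by apply: eq_map => q /=; rewrite permK.
(* Weighted difference of the unknowns after relabelling by [s]; by [sumE], the test matrix
   annihilates it. *)
pose v (u : r.-tuple 'I_Q) : R := (\prod_(q <- u) proportion th q) *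
  (partial_connection th u - partial_connection th' (map_tuple s^-1%g u)).
have v0 : test_mx th r *m (\col_i v (enum_val i)) = 0.
  apply/matrixP => i j; rewrite !mxE.
  under eq_bigr => l _ do rewrite !mxE.
  rewrite -(big_enum_val (fun u : r.-tuple 'I_Q =>
    test_fun th (map val (enum_val i : r.-tuple 'I_Q)) u * v u)) /=.
  transitivity (\sum_(u : r.-tuple 'I_Q) ((\prod_(q <- u) proportion th q) *
      (partial_connection th u * test_fun th (map val (enum_val i : r.-tuple 'I_Q)) u)
     - (\prod_(q <- u) proportion th q) *
      (partial_connection th' (map_tuple s^-1%g u) *
         test_fun th (map val (enum_val i : r.-tuple 'I_Q)) u))).
    by apply: eq_big => // u _; rewrite /v; ring.
  rewrite sumrB sumE [X in _ - X](reindex_inj (can_inj mapK)) -sumrB big1// => u _.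
  rewrite mapK testE /= big_map; under eq_bigr => q _ do rewrite prop_s.
  by rewrite subrr.
have {}v0 u : v u = 0.
  have := congr1 (fun A : 'cV_ _ => A (enum_rank u) ord0)
    (mulKmx (unit_th r _) (\col_i v (enum_val i))).
  by rewrite v0 mulmx0 !mxE enum_rankK r_gt1 rm => <-.
have wrE : size w == r by apply/eqP.
have /eqP := v0 (map_tuple s (Tuple wrE)).
rewrite mulf_eq0 mapK subr_eq0 => /orP[|/eqP//].
by rewrite prodf_seq_eq0 => /hasP[q _] /=; rewrite (negbTE (pn q)).
Qed.

End Connections.

Lemma recover_param : label_switching th th'.
Proof.
have [s [prop_s deg_s]] := recover_proportion.
exists s; split=> // q; rewrite -!partial_connection_tuple.
by rewrite (recover_partial_connection prop_s deg_s (leqnn m)) ?size_tuple.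
Qed.

End Recovery.

(** * Comparison of the sample size bounds *)

(** Pairing the factors [i + 1] and [m - i] of two copies of [m!], whose product is at least [m],
    gives [m ^ m <= m! ^ 2]. *)
Lemma expn_pred_leq_fact (m : nat) : (0 < m)%N -> (m ^ m.-1 <= (m`! * m) ^ 2)%N.
Proof.
move=> m0; apply: (@leq_trans (m ^ m)); first by rewrite leq_pexp2l ?leq_pred.
apply: (@leq_trans (m`! ^ 2)); last by rewrite leq_exp2r// leq_pmulr.
have factE : m`! = \prod_(i < m) i.+1.
  by rewrite fact_prod big_add1 big_mkord.
rewrite -mulnn {2}factE (reindex_inj rev_ord_inj) factE -big_split /=.
rewrite -[leqLHS]/((m ^ m)%N) -[X in (m ^ X)%N]card_ord -prod_nat_const.
apply: leq_prod => i _ /=; rewrite subnSK//.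
by have := ltn_ord i; nia.
Qed.

(** The base [X] is at least [m! * m], so [X ^ 2 >= m ^ (m - 1)], and the root of order [m - 1]
    gives [X ^ (2 / (m - 1)) >= m]. *)
Lemma sample_size_bound (R : realType) (m Q n : nat) : (2 <= m)%N -> (0 < Q)%N ->
  Q%:R ^+ 2 * (m`!%:R * Q%:R * m%:R + m%:R - 1) `^ (2 / (m%:R - 1)) <= n%:R :> R ->
  (Q ^ 2 * m <= n)%N.
Proof.
move=> m2 Q0 hn; rewrite -(ler_nat R) natrM natrX; apply: le_trans hn.
rewrite ler_wpM2l ?exprn_ge0//.
set X := _ + _ - 1.
have X1 : (m`! * m)%:R <= X :> R.
  have -> : X = (m`! * Q * m + m.-1)%:R.
    by rewrite /X natrD !natrM -[in X in _ = _ + X]subn1 natrB ?(ltnW m2)// addrA.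
  by rewrite ler_nat; nia.
have X0 : 0 <= X by apply: le_trans X1.
have m10 : 0 < m%:R - 1 :> R by rewrite subr_gt0 ltr1n.
rewrite powRrM powR_mulrn//.
have m_pow : m%:R = (m%:R ^+ m.-1) `^ (m%:R - 1)^-1 :> R.
  rewrite -powR_mulrn// -powRrM -[m.-1]subn1 natrB ?(ltnW m2)//.
  by rewrite mulfV ?gt_eqF// powRr1.
rewrite {1}m_pow ge0_ler_powR ?nnegrE ?invr_ge0 ?exprn_ge0 ?(ltW m10)//.
apply: (@le_trans _ _ ((m`! * m)%:R ^+ 2)).
  by rewrite -!natrX ler_nat expn_pred_leq_fact// ltnW.
by rewrite lerXn2r ?nnegrE.
Qed.

(** For [Q = 0] the parameter space is empty, of dimension 0, and no [E] has a smaller one. If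
    [p q = 0], the connection values at [q] do not affect the law. *)
Theorem theorem2 (R : realType) (m Q n : nat) (m_ge2 : (2 <= m)%N)
    (Q_gt0 : (0 < Q)%N)
    (n_large : Q%:R ^+ 2 * (m`!%:R * Q%:R * m%:R + m%:R - 1) `^ (2 / (m%:R - 1))
                 <= n%:R :> R) :
  generically_identifiable (@hsbm_space R Q m) (@hsbm_law R Q m n)
    (@label_switching R Q m)
  /\
  forall p : 'I_Q -> R, (forall q, 0 < p q) -> \sum_q p q = 1 ->
    generically_identifiable (@hsbm_space_fixed R Q m p) (@hsbm_law R Q m n)
      (@label_switching R Q m).
Proof.
have nQm := sample_size_bound m_ge2 Q_gt0 n_large.
have polyF := @polynomial_fun_generic_fun R Q m.
have F_neq0 := fun p p0 => @generic_fun_neq0 R Q m p (ltnW m_ge2) Q_gt0 p0.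
split=> [|p p0 p1].
- exists [set th | hsbm_space th /\ generic_fun th = 0%R]%classic; split.
  + by move=> th [].
  (* Uniform proportions complete the witness where [generic_fun] is nonzero. *)
  + apply: (dimension_hsbm_space_zero Q_gt0 polyF _ (F_neq0 (fun=> Q%:R^-1) _)).
      by rewrite sumr_const card_ord -[_ *+ _]mulr_natr mulVf// pnatr_eq0 -lt0n.
    by move=> q; rewrite invr_gt0 ltr0n.
  + move=> th th' thS thE th'S law_eq.
    apply: (recover_param m_ge2 Q_gt0 nQm law_eq); [by case: thS|by case: th'S|].
    by apply/eqP => F0; apply: thE.
- exists [set th | hsbm_space_fixed p th /\ generic_fun th = 0%R]%classic; split.
  + by move=> th [].
  + apply: (dimension_hsbm_space_fixed_zero Q_gt0 _ p1 polyF _ (F_neq0 p p0)) => //.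
    by move=> q; exact: ltW.
  + move=> th th' thS thE th'S law_eq.
    apply: (recover_param m_ge2 Q_gt0 nQm law_eq); [by case: thS => -[]|by case: th'S => -[]|].
    by apply/eqP => F0; apply: thE.
Qed.
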